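(* Let $a,b\in\mathbb{R}$ and let $h$ be the range-angle measurement function $$h(x)=\begin{bmatrix}\sqrt{(x(1)-a)^2+(x(2)-b)^2}\\ \arctan\!\left(\frac{x(2)-b}{x(1)-a}\right)\end{bmatrix},\qquad x=(x(1),x(2))\in\mathbb{R}^2.$$ Let $x\in\mathbb{R}^2$, let $P\in\mathbb{R}^{2\times 2}$ be symmetric positive definite, and let $E$ be the Cholesky factor of $P$ ($P=EE^T$). Assume that the set $\{x+Eu: u\in\mathbb{R}^2,\ \|u\|\le 1\}$ does not intersect the ray $\{z\in\mathbb{R}^2: z(1)\le a,\ z(2)=b\}$. Define the remainder $$g(u)=h(x+Eu)-h(x)-J_hEu,\qquad \|u\|\le 1,$$ where $J_h$ is the Jacobian matrix of $h$ at $x$. Then the (topological) boundary in $\mathbb{R}^2$ of the set $S=\{g(u):\|u\|\le 1\}$ is contained in $\{g(u):\|u\|=1\}$.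
   Context: $\|\cdot\|$ is the Euclidean norm. The Cholesky factor $E$ of $P$ is the lower triangular matrix with positive diagonal entries with $P=EE^T$. In the second component of $h$, $\arctan\left(\frac{x(2)-b}{x(1)-a}\right)$ denotes the four-quadrant angle, i.e. the polar angle in $(-\pi,\pi)$ of the vector $(x(1)-a,x(2)-b)$, which is smooth on the complement of the ray $\{x(1)\le a,\ x(2)=b\}$. *)

(* Defs.v *)
From mathcomp Require Import all_boot all_order all_algebra.
From mathcomp Require Import all_classical all_reals all_analysis.
From mathcomp Require Import ring lra.

Set Implicit Arguments.
Unset Strict Implicit.
Unset Printing Implicit Defensive.

Import Order.TTheory GRing.Theory Num.Theory.
Import numFieldNormedType.Exports.

Local Open Scope classical_set_scope.
Local Open Scope ring_scope.

(* Vectors are rows, as in the differential calculus of MathComp-Analysis: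
   z(1) and z(2) are z 0 0 and z 0 1, the product M z is written z *m M^T, and
   the library's jacobian 'J f z is the transpose of the matrix with entries
   (d f_i / d z_j)_(i, j). *)

(* The norm `|u| that the library puts on matrices is the sup norm. *)
Definition euclid_norm (R : realType) n (u : 'rV[R]_n) : R :=
  Num.sqrt (\sum_i u 0 i ^+ 2).

Definition boundary (T : topologicalType) (A : set T) : set T :=
  closure A `\` interior A.

Definition sym_posdef (R : realType) n (P : 'M[R]_n) : Prop :=
  P^T = P /\ forall v : 'rV[R]_n, v != 0 -> 0 < (v *m P *m v^T) 0 0.

Definition is_cholesky_factor (R : realType) n (P E : 'M[R]_n) : Prop :=
  [/\ is_trig_mx E, forall i, 0 < E i i & P = E *m E^T].

Definition is_polar_angle (R : realType) (x y t : R) : Prop :=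
  [/\ - pi < t < pi, x = Num.sqrt (x ^+ 2 + y ^+ 2) * cos t
    & y = Num.sqrt (x ^+ 2 + y ^+ 2) * sin t].

(* Well defined off the ray x <= 0, y = 0 (see polar_angleP); arbitrary on
   that ray. *)
Definition polar_angle (R : realType) (x y : R) : R :=
  get (is_polar_angle x y).

Lemma cos_sin_inj (R : realType) (t u : R) : - pi < t < pi -> - pi < u < pi ->
  cos t = cos u -> sin t = sin u -> t = u.
Proof.
move=> t_pi u_pi ctu stu.
have cos_abs (v : R) : cos `|v| = cos v.
  by case: (ger0P v) => // _; rewrite cosN.
have abs_itv (v : R) : - pi < v < pi -> `|v| \in `[0, pi].
  by move=> v_pi; rewrite in_itv /= normr_ge0 ltW// ltr_norml.
have /eqP : `|t| = `|u|.
  by apply: cos_inj; rewrite ?cos_abs//; exact: abs_itv.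
rewrite eqr_norm2 => /orP[/eqP//|/eqP tE].
have su0 : sin u = 0 by move: stu; rewrite tE sinN; lra.
have [u0|u0|u0] := ltgtP u 0; last by rewrite tE u0 oppr0.
- have : 0 < sin (- u) by apply: sin_gt0_pi; lra.
  by rewrite sinN su0 oppr0 ltxx.
- have : 0 < sin u by apply: sin_gt0_pi; lra.
  by rewrite su0 ltxx.
Qed.

Lemma polar_angleP (R : realType) (x y t : R) : ~ (x <= 0 /\ y = 0) ->
  polar_angle x y = t <-> is_polar_angle x y t.
Proof.
move=> xy; set r := Num.sqrt (x ^+ 2 + y ^+ 2).
have r2 : r ^+ 2 = x ^+ 2 + y ^+ 2 by rewrite sqr_sqrtr// addr_ge0// sqr_ge0.
have r_ge0 : 0 <= r by exact: sqrtr_ge0.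
have rx_gt0 : 0 < r + x.
  have [x0|x0] := ltP 0 x; first by lra.
  have y2 : 0 < y ^+ 2.
    by rewrite exprn_even_gt0//=; apply/eqP => y0; apply: xy.
  by nra.
have r_gt0 : 0 < r.
  rewrite lt0r r_ge0 andbT; apply/eqP => r0.
  by move: r2 rx_gt0; rewrite r0; nra.
have uniq u v : is_polar_angle x y u -> is_polar_angle x y v -> u = v.
  move=> [u_pi xu yu] [v_pi xv yv]; apply: cos_sin_inj => //.
    by apply: (mulfI (lt0r_neq0 r_gt0)); rewrite -xu -xv.
  by apply: (mulfI (lt0r_neq0 r_gt0)); rewrite -yu -yv.
have [u u_angle] : exists u, is_polar_angle x y u.
  pose s := y / (r + x); exists (atan s *+ 2).
  have a_lt := atan_ltpi2 s; have a_gt := atan_gtNpi2 s.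
  have c_gt0 : 0 < cos (atan s) by apply: cos_gt0_pihalf; rewrite a_gt a_lt.
  have sE : sin (atan s) = s * cos (atan s).
    by rewrite -{2}(atanK s) /tan mulfVK// gt_eqF.
  have cs := cos2Dsin2 (atan s).
  have c2 : cos (atan s) ^+ 2 = (r + x) / (2 * r).
    have s2 : s ^+ 2 = (r - x) / (r + x).
      have -> : s ^+ 2 = y ^+ 2 / (r + x) ^+ 2 by rewrite /s expr_div_n.
      have -> : y ^+ 2 = (r - x) * (r + x) by lra.
      by field; lra.
    move: cs; rewrite sE exprMn s2 => cs.
    have cs1 : cos (atan s) ^+ 2 * (2 * r / (r + x)) = 1.
      by rewrite -[RHS]cs; field; lra.
    by rewrite -[RHS]mul1r -[X in X * _]cs1; field; lra.
  split.
  - by rewrite mulr2n; lra.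
  - by rewrite cos_mulr2n c2 -/r mulr2n; field; lra.
  - rewrite sin_mulr2n sE -/r mulr2n.
    have -> : cos (atan s) * (s * cos (atan s)) = s * cos (atan s) ^+ 2 by ring.
    by rewrite c2 /s; field; lra.
have getP : is_polar_angle x y (polar_angle x y) by exact: (getI u_angle).
by split=> [<-//|]; exact: uniq.
Qed.

Lemma polar_angle_atan (R : realType) (x y : R) : 0 < x ->
  polar_angle x y = atan (y / x).
Proof.
move=> x0; apply/polar_angleP; first by lra.
rewrite /is_polar_angle; set r := Num.sqrt _.
have a_lt := atan_ltpi2 (y / x); have a_gt := atan_gtNpi2 (y / x).
have rE : r = x * Num.sqrt (1 + (y / x) ^+ 2).
  rewrite -[x in x * _]gtr0_norm// -sqrtr_sqr -sqrtrM ?sqr_ge0//.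
  by congr Num.sqrt; field; lra.
have q_gt0 : 0 < Num.sqrt (1 + (y / x) ^+ 2).
  by rewrite sqrtr_gt0 ltr_wpDr ?sqr_ge0.
have xE : x = r * cos (atan (y / x)).
  by rewrite cos_atan rE mulfK// gt_eqF.
split=> //; first by have := pi_gt0 R; lra.
have c_gt0 : 0 < cos (atan (y / x)) by apply: cos_gt0_pihalf; rewrite a_gt a_lt.
have -> : sin (atan (y / x)) = y / x * cos (atan (y / x)).
  by rewrite -{2}(atanK (y / x)) /tan mulfVK// gt_eqF.
by rewrite mulrCA -xE mulfVK// gt_eqF.
Qed.

Definition range_angle (R : realType) (a b : R) (z : 'rV[R]_2) : 'rV[R]_2 :=
  \row_(i < 2) if i == 0
    then Num.sqrt ((z 0 0 - a) ^+ 2 + (z 0 1 - b) ^+ 2)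
    else polar_angle (z 0 0 - a) (z 0 1 - b).

(* Main.v *)
(* The determinant of 'J h z - 'J h x is nonnegative and vanishes exactly when z
   lies on the open half-line from (a, b) through x. So the fold points of g
   form a chord of the disc, on which g = 0; this chord reaches the unit circle,
   whence every critical value of g in the open disc is already a value on the
   circle. A point outside of g(disc) is nearest to a critical value or to a
   value on the circle, hence to a value on the circle in both cases, and
   boundary points of g(disc) are limits of such nearest points. *)
Require Import Defs.
From mathcomp Require Import all_boot all_order all_algebra.
From mathcomp Require Import all_classical all_reals all_analysis.
From mathcomp Require Import ring lra.

Set Implicit Arguments.
Unset Strict Implicit.
Unset Printing Implicit Defensive.

Import Order.TTheory GRing.Theory Num.Theory.
Import numFieldNormedType.Exports.
Local Open Scope classical_set_scope.
Local Open Scope ring_scope.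

(** * Differentiability as a local property, and Fermat's rule *)

Lemma near_eq_differentiable (R : realFieldType) (V W : normedModType R)
    (f g : V -> W) (x : V) :
  {near x, f =1 g} -> differentiable f x -> differentiable g x.
Proof.
move=> fg /diff_locallyP[dfc fE].
(* The first-order expansion depends only on values near [x], so [g] inherits that of [f], with the
   same linear part. *)
have gE : g \o shift x = cst (g x) + 'd f x +o_ 0 id.
  apply/eqaddoP => e e0.
  have /eqaddoP/(_ e e0) := fE; apply: filter_app.
  have : \forall z \near 0, f (z + x) = g (z + x).
    have := fg; rewrite (near_shift 0 x).
    by apply: filter_app; near=> z; rewrite /= subr0.
  apply: filter_app; near=> z => fgz.
  by rewrite !fctE /= fgz (nbhs_singleton fg).
have dgE : 'd g x = 'd f x :> (V -> W) by exact: diff_unique.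
by apply/diff_locallyP; rewrite dgE.
Unshelve. all: by end_near. Qed.

(** Restricted to the line through [u] along [v], the function has a local minimum at parameter [0],
    where the one-variable rule applies. *)
Lemma derive_local_min (R : realType) (V : normedModType R) (f : V -> R)
    (u v : V) :
  (\forall z \near u, derivable f z v) -> (\forall z \near u, f u <= f z) ->
  'D_v f u = 0.
Proof.
move=> fder fmin; pose F t := f (t *: v + u).
have F_growth t h : F (h *: 1 + t) = f (h *: v + (t *: v + u)).
  by rewrite /F [h%:A]mulr1 scalerDl addrA.
have line0 : (fun t : R => t *: v + u) @ 0 --> u.
  rewrite -[X in _ --> X]add0r -[X in _ --> X + _](scale0r v).
  by apply: cvgD; [apply: cvgZr_tmp; exact: cvg_id | exact: cvg_cst].
have [e e0 He] : exists2 e : R, 0 < e & forall t, t \in `]- e, e[%R ->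
    derivable f (t *: v + u) v /\ f u <= f (t *: v + u).
  have /nbhs_ballP[e e0 He] : \forall t \near (0 : R),
      derivable f (t *: v + u) v /\ f u <= f (t *: v + u).
    exact: line0 _ (filterI fder fmin).
  exists e => // t; rewrite in_itv/= -ltr_norml => te; apply: He.
  by rewrite /ball/= sub0r normrN.
have F0 : is_derive (0 : R) (1 : R) F 0.
  apply: (@derive1_at_min _ F (- e) e).
  - lra.
  - move=> t /He[+ _]; rewrite /derivable.
    by under [X in cvg (X @ _)]eq_fun do rewrite /= -F_growth.
  - by rewrite in_itv/= oppr_lt0 e0.
  - by move=> t /He[_]; rewrite {1}/F scale0r add0r.
rewrite -(@derive_val _ _ _ _ _ _ _ F0) /derive.
by under [in RHS]eq_fun do rewrite /= F_growth /F scale0r add0r.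
Qed.

(** Minimised in place of the sup norm, because it is differentiable and its critical point equation
    is a dot product. *)
Definition sqr_norm (R : realType) n (v : 'rV[R]_n) : R := \sum_i v 0 i ^+ 2.

Lemma sqr_norm_le (R : realType) n (v : 'rV[R]_n) (M : R) :
  0 <= M -> sqr_norm v <= M ^+ 2 -> `|v| <= M.
Proof.
move=> M0 vM; rewrite /Num.Def.normr/= mx_normrE (bigmax_le _ M0)//= => -[i j] _.
rewrite -(ger0_norm M0) -ler_sqr ?nnegrE// !real_normK ?num_real//=.
apply: le_trans vM; rewrite (ord1 i) /sqr_norm (bigD1 j)//= lerDl.
by apply: sumr_ge0 => k _; exact: sqr_ge0.
Qed.

(** With [sqr_norm_le], this passes between Euclidean nearest points and sup-norm balls. The factor
    [n], cruder than its square root, avoids radicals. *)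
Lemma sqr_norm_ge (R : realType) n (v : 'rV[R]_n) (M : R) :
  `|v| <= M -> sqr_norm v <= (n%:R * M) ^+ 2.
Proof.
move=> vM; have M0 : 0 <= M by exact: le_trans vM.
have vi i : v 0 i ^+ 2 <= M ^+ 2.
  rewrite -[v 0 i ^+ 2]real_normK ?num_real// ler_sqr ?nnegrE//.
  apply: le_trans vM.
  by rewrite [leRHS]/Num.Def.normr/= mx_normrE; exact: (le_bigmax _ _ (0, i)).
apply: (@le_trans _ _ (\sum_(i < n) M ^+ 2)); first exact: ler_sum.
rewrite sumr_const card_ord -[leLHS]mulr_natl exprMn.
rewrite ler_wpM2r ?sqr_ge0// -natrX ler_nat.
by case: n {v vM vi} => // n; rewrite -{1}[n.+1]expn1 leq_pexp2l.
Qed.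

Lemma sqr_norm_continuous (R : realType) n : continuous (@sqr_norm R n).
Proof.
move=> v; apply: (@cvg_big R _ +%R 0 _ _ _ (nbhs v)) => [|i _].
  exact: add_continuous.
apply: (@continuous_comp _ _ _ (fun w : 'rV[R]_n => w 0 i) (fun x : R => x ^+ 2)).
  exact: coord_continuous.
exact: exprn_continuous.
Qed.

Lemma derive_coord (R : realType) (V : normedModType R) m (f : V -> 'rV[R]_m)
    (u v : V) i : derivable f u v ->
  is_derive u v (fun z => f z 0 i) ('D_v f u 0 i).
Proof.
move=> fu; apply: DeriveDef; first by move/derivable_mxP : fu; exact.
by rewrite derive_mx// mxE.
Qed.

Lemma derive_sqr_norm (R : realType) (V : normedModType R) m
    (f : V -> 'rV[R]_m) (u v : V) : derivable f u v ->
  is_derive u v (fun z => sqr_norm (f z)) (2 * \sum_i f u 0 i * 'D_v f u 0 i).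
Proof.
move=> fu; pose F i (z : V) := f z 0 i ^+ 2.
have dF i : is_derive u v (F i) (2 * (f u 0 i * 'D_v f u 0 i)).
  have fi := derive_coord i fu.
  have := is_deriveX 2 fi.
  by move=> /is_derive_eq; apply; rewrite /GRing.scale/= expr1 -mulrA mulr_natl.
have := is_derive_sum dF.
rewrite -mulr_sumr => dS; suff -> : (fun z => sqr_norm (f z)) = \sum_i F i by [].
by apply/funext => z; rewrite fct_sumE.
Qed.

(** * Boundary of the image of a compact set *)

Lemma row_full_ortho (F : fieldType) n m (J : 'M[F]_(n, m)) (d : 'rV[F]_m) :
  row_full J -> (forall w : 'rV[F]_n, w *m J *m d^T = 0) -> d = 0.
Proof.
(* As [B *m J] is the identity, the rows of [B], taken as test vectors [w], recover every entry of
   [d]. *)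
move=> /row_fullP[B BJ] Jd; apply: trmx_inj; rewrite trmx0 -[d^T]mul1mx -BJ.
by apply/row_matrixP => i; rewrite -mulmxA row_mul row0 mulmxA Jd.
Qed.

(* A point q outside of the image is nearest to a point g u with either u in C
   or 'J g u degenerate, since at other minimizers of |g u - q|^2 the critical
   point equation forces g u = q. Letting q tend to a boundary point exhibits
   the latter as a limit of points of g @` C. *)
Lemma boundary_image_sub (R : realType) n m (K C : set 'rV[R]_n)
    (g : 'rV[R]_n -> 'rV[R]_m) :
  compact K -> compact C -> C `<=` K -> K `\` C `<=` interior K ->
  {within K, continuous g} ->
  (forall u, (K `\` C) u -> differentiable g u) ->
  (forall u, (K `\` C) u -> ~~ row_full ('J g u) -> (g @` C) (g u)) ->
  boundary (g @` K) `<=` g @` C.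
Proof.
move=> Kco Cco CK KC_int gc gd gcrit p [pcl pint].
have clC : closed C by apply: compact_closed => //; exact: norm_hausdorff.
have nearest q : ~ (g @` K) q -> K !=set0 -> exists2 c, C c &
    forall u, K u -> sqr_norm (g c - q) <= sqr_norm (g u - q).
  move=> qK K0; pose phi u := sqr_norm (g u - q).
  have phic : {within K, continuous phi}.
    move=> u.
    apply: (@continuous_comp _ _ _ (fun z : subspace K => g z - q)).
      by apply: cvgB; [exact: gc | exact: cvg_cst].
    exact: sqr_norm_continuous.
  have [u /set_mem Ku umin] := EVT_min_rV K0 Kco phic.
  have [Cu|nCu] := pselect (C u).
    by exists u => // z Kz; apply: umin; exact/mem_set.
  suff [c Cc gcu] : (g @` C) (g u).
    by exists c => // z Kz; rewrite gcu; apply: umin; exact/mem_set.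
  apply: gcrit => //; apply/negP => Jfull; apply: qK; exists u => //.
  apply/subr0_eq/(row_full_ortho Jfull) => w.
  have KCnbhs : \forall z \near u, (K `\` C) z.
    apply: filterI; first exact: KC_int.
    exact: (open_nbhs_nbhs (conj (closed_openC clC) nCu)).
  have derB z : differentiable g z -> derivable (fun z => g z - q) z w.
    by move=> dg; apply: derivableB => //; exact: diff_derivable.
  (* This derivative is twice the dot product of [g u - q] with [w *m 'J g u], so its vanishing
     gives the orthogonality required by [row_full_ortho]. *)
  have : 'D_w phi u = 0.
    apply: derive_local_min.
    - apply: filterS KCnbhs => z /gd /derB /derive_sqr_norm dz.
      exact: ex_derive.
    - by apply: filterS KCnbhs => z [Kz _]; apply: umin; exact/mem_set.
  have du := gd _ (conj Ku nCu).
  have -> := @derive_val _ _ _ _ _ _ _ (derive_sqr_norm (derB _ du)).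
  rewrite deriveB//; last exact: diff_derivable.
  rewrite derive_cst subr0 deriveEjacobian// => /eqP.
  rewrite mulf_eq0 pnatr_eq0/= => /eqP sum0.
  apply/rowP => i; rewrite (ord1 i) !mxE -[RHS]sum0.
  by apply: eq_bigr => j _; rewrite mulrC [d in d * _]mxE.
(* The image of the compact set [C] is closed, so approximating [p] by its points suffices. *)
suff : closure (g @` C) p.
  apply: compact_closed; first exact: norm_hausdorff.
  by apply: continuous_compact => //; exact: continuous_subspaceW gc.
move=> B /nbhs_ballP[e /= e0 eB].
(* Chosen so that [d + m * (2 * d) = e]: [q] is within [d] of [p], and [g c] within [m * (2 * d)] of
   [q]. The added [1] covers [m = 0]. *)
pose d := e / (2 * m%:R + 1).
have d0 : 0 < d by rewrite divr_gt0// ltr_wpDl// mulr_ge0.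
have [q qK pq] : exists2 q, ~ (g @` K) q & `|p - q| < d.
  apply: contrapT => /forall2NP H; apply: pint.
  apply/nbhs_ballP; exists d => // q; rewrite -ball_normE/= => pq.
  by have [/contrapT|/(_ pq)] := H q.
have [_ [[k Kk <-]]] := pcl _ (nbhsx_ballx p d d0).
rewrite -ball_normE/= => pk.
have [c Cc cmin] := nearest q qK (ex_intro _ k Kk).
exists (g c); split; first by exists c.
apply: eB; rewrite -ball_normE/=.
(* The value [g k] near [p] bounds the minimal distance from [q]; switching norms costs the factor
   [m]. *)
have kq : `|g k - q| <= 2 * d.
  rewrite -(subrKA p) (le_trans (ler_normD _ _))// distrC.
  by rewrite mulr_natl mulr2n lerD// ltW.
have cq : `|g c - q| <= m%:R * (2 * d).
  apply: sqr_norm_le; first by rewrite !mulr_ge0// ltW.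
  exact: le_trans (cmin _ Kk) (sqr_norm_ge kq).
rewrite -(subrKA q) (le_lt_trans (ler_normD _ _))//.
have -> : e = d + m%:R * (2 * d).
  by have m0 := ler0n R m; rewrite /d; field; lra.
by rewrite ltr_leD// distrC.
Qed.

(** * Chain rule for a scalar function of a vector *)

Section chain_rule.
Context {R : realType} {V : normedModType R}.
Implicit Types (f : V -> R) (phi : R -> R) (z v : V).

Lemma differentiable_comp1 f phi z (l : R) :
  differentiable f z -> is_derive (f z) 1 phi l ->
  differentiable (fun x => phi (f x)) z.
Proof.
move=> fz [phiz _].
by apply: (differentiable_comp fz); exact/derivable1_diffP.
Qed.

Lemma is_derive_comp1 f phi z v (l : R) :
  differentiable f z -> is_derive (f z) 1 phi l ->
  is_derive z v (fun x => phi (f x)) (l * 'D_v f z).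
Proof.
move=> fz dphi; apply: DeriveDef.
  exact/diff_derivable/(differentiable_comp1 fz dphi).
have [phiz phil] := dphi.
have dphiz : differentiable phi (f z) by exact/derivable1_diffP.
rewrite deriveE; last exact: differentiable_comp1 fz dphi.
rewrite (diff_comp fz dphiz)/= diff1E// derive1E phil mulrC.
by rewrite deriveE.
Qed.

End chain_rule.

(** * Polar radius and angle in the plane *)

Definition radius (R : realType) (X Y : R) : R := Num.sqrt (X ^+ 2 + Y ^+ 2).

Section radius.
Context {R : realType}.
Implicit Types X Y : R.

Lemma radius_ge0 X Y : 0 <= radius X Y. Proof. exact: sqrtr_ge0. Qed.

Lemma sqr_radius X Y : radius X Y ^+ 2 = X ^+ 2 + Y ^+ 2.
Proof. by rewrite sqr_sqrtr// addr_ge0// sqr_ge0. Qed.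

Lemma radiusZ (l X Y : R) : 0 <= l -> radius (l * X) (l * Y) = l * radius X Y.
Proof.
move=> l0; rewrite /radius !exprMn -mulrDr sqrtrM ?sqr_ge0//.
by rewrite sqrtr_sqr ger0_norm.
Qed.

(** From [(r - X) * (r + X) = Y ^+ 2]. The strict inequality is an open condition and keeps the
    half-angle denominator positive. *)
Lemma off_rayP X Y : ~ (X <= 0 /\ Y = 0) <-> 0 < radius X Y + X.
Proof.
have r0 := radius_ge0 X Y; have r2 := sqr_radius X Y; split=> [XY|rX [X0 Y0]].
- have [X0|X0] := ltP 0 X; first by lra.
  have : 0 < Y ^+ 2 by rewrite exprn_even_gt0//=; apply/eqP => Y0; apply: XY.
  by nra.
- have /(mulr_gt0 rX) : 0 < radius X Y - X by lra.
  by rewrite mulrC -subr_sqr r2 Y0 expr0n addr0 subrr ltxx.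
Qed.

Lemma radius_gt0 X Y : 0 < radius X Y + X -> 0 < radius X Y.
Proof.
have := radius_ge0 X Y; rewrite le_eqVlt => /predU1P[r0|//].
by have := sqr_radius X Y; rewrite -r0; nra.
Qed.

(* Half-angle formula tan (t / 2) = sin t / (1 + cos t). *)
Lemma polar_angleE X Y : 0 < radius X Y + X ->
  polar_angle X Y = atan (Y / (radius X Y + X)) *+ 2.
Proof.
move=> rX; have r_gt0 := radius_gt0 rX.
have [t_pi Xt Yt] := (polar_angleP _ (iffRL (off_rayP X Y) rX)).1 erefl.
set t := polar_angle X Y in t_pi Xt Yt *.
rewrite -/(radius X Y) in Xt Yt; set r := radius X Y in rX r_gt0 Xt Yt *.
pose s := t / 2.
have tE : t = s *+ 2 by rewrite /s -mulr_natr divfK.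
have s_pi : - (pi / 2) < s < pi / 2.
  by rewrite /s; lra.
have c_gt0 : 0 < cos s by apply: cos_gt0_pihalf.
rewrite -/t tE; congr (_ *+ 2).
suff -> : Y / (r + X) = tan s by rewrite tanK// in_itv/= s_pi.
have -> : r + X = r * cos s ^+ 2 *+ 2.
  by rewrite Xt tE cos_mulr2n !mulr2n; ring.
rewrite Yt tE sin_mulr2n /tan !mulr2n; field.
have rc_gt0 := mulr_gt0 r_gt0 (exprn_gt0 2 c_gt0).
by rewrite !gt_eqF//; lra.
Qed.

(** The half-angle quotient is homogeneous of degree zero. *)
Lemma polar_angleZ (l X Y : R) : 0 < l -> 0 < radius X Y + X ->
  polar_angle (l * X) (l * Y) = polar_angle X Y.
Proof.
move=> l0 rX; rewrite !polar_angleE// radiusZ ?ltW// -mulrDr ?mulr_gt0//.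
by rewrite -mulf_div divff ?gt_eqF// mul1r.
Qed.

End radius.

(** * Differential of the range-angle map *)

Section range_angle.
Context {R : realType} (a b : R).
Local Notation rho := (fun z : 'rV[R]_2 => radius (z 0 0 - a) (z 0 1 - b)).
Local Notation theta := (fun z : 'rV[R]_2 => polar_angle (z 0 0 - a) (z 0 1 - b)).
Implicit Types z v : 'rV[R]_2.

Definition off_ray z := 0 < radius (z 0 0 - a) (z 0 1 - b) + (z 0 0 - a).

Let differentiable_shift z (i : 'I_2) (k : R) :
  differentiable (fun z : 'rV[R]_2 => z 0 i - k) z.
Proof. by apply: differentiableB => //; exact: differentiable_coord. Qed.

Let is_derive_shift z v (i : 'I_2) (k : R) :
  is_derive z v (fun z : 'rV[R]_2 => z 0 i - k) (v 0 i).
Proof.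
apply: DeriveDef; first exact/diff_derivable/differentiable_shift.
have dv := @derive_coord R 'rV[R]_2 2 id z v i (@derivable_id _ _ z v).
have := @is_deriveB _ _ _ _ _ _ _ _ _ dv (is_derive_cst k z v).
by move/@derive_val => ->; rewrite derive_id subr0.
Qed.

Let differentiable_sqr z : differentiable
  (fun z : 'rV[R]_2 => (z 0 0 - a) ^+ 2 + (z 0 1 - b) ^+ 2) z.
Proof.
have dX := differentiableX 1 (differentiable_shift z 0 a).
have dY := differentiableX 1 (differentiable_shift z 1 b).
exact: differentiableD dX dY.
Qed.

Lemma differentiable_rho z : off_ray z -> differentiable rho z.
Proof.
move=> /radius_gt0; rewrite sqrtr_gt0 => s_gt0.
exact: differentiable_comp1 (differentiable_sqr z) (is_derive1_sqrt s_gt0).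
Qed.

Lemma is_derive_rho z v : off_ray z ->
  is_derive z v rho
    (((z 0 0 - a) * v 0 0 + (z 0 1 - b) * v 0 1) / rho z).
Proof.
move=> /radius_gt0; rewrite sqrtr_gt0 => s_gt0.
apply: is_derive_eq (is_derive_comp1 v (differentiable_sqr z) (is_derive1_sqrt s_gt0)) _.
have dX := is_deriveX 2 (is_derive_shift z v 0 a).
have dY := is_deriveX 2 (is_derive_shift z v 1 b).
rewrite (@derive_val _ _ _ _ _ _ _ (is_deriveD dX dY)) /GRing.scale/= !expr1.
rewrite -/(radius _ _); field.
by rewrite gt_eqF// sqrtr_gt0.
Qed.

(** The tangent of half the polar angle; differentiability of [theta] is obtained through
    [2 * atan (psi z)]. *)
Let psi z := (z 0 1 - b) / (rho z + (z 0 0 - a)).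

Let differentiable_psi z : off_ray z -> differentiable psi z.
Proof.
move=> oz; apply: differentiableM; first exact: differentiable_shift.
apply: differentiableV; last by rewrite gt_eqF.
by apply: differentiableD; [exact: differentiable_rho|exact: differentiable_shift].
Qed.

Let near_off_ray z : off_ray z -> \forall y \near z, off_ray y.
Proof.
move=> oz.
have : {for z, continuous (fun z => rho z + (z 0 0 - a))}.
  apply: differentiable_continuous; apply: differentiableD.
    exact: differentiable_rho.
  exact: differentiable_shift.
by move=> /(_ [set x | 0 < x]); apply; exact: lt_nbhsr.
Qed.

Let near_theta z : off_ray z -> {near z, (fun z => 2 * atan (psi z)) =1 theta}.
Proof.
move=> /near_off_ray; apply: filterS => y oy.
by rewrite polar_angleE// mulr_natl.
Qed.

Lemma differentiable_theta z : off_ray z -> differentiable theta z.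
Proof.
move=> oz; apply: near_eq_differentiable (near_theta oz) _.
apply: differentiableZ.
exact: differentiable_comp1 (differentiable_psi oz) (is_derive1_atan _).
Qed.

Lemma is_derive_theta z v : off_ray z ->
  is_derive z v theta
    (((z 0 0 - a) * v 0 1 - (z 0 1 - b) * v 0 0) / rho z ^+ 2).
Proof.
move=> oz; apply: near_eq_is_derive (near_theta oz) _.
have dpsi := is_derive_comp1 v (differentiable_psi oz) (is_derive1_atan _).
apply: is_derive_eq (is_deriveZ 2 dpsi) _.
have oz' : rho z + (z 0 0 - a) != 0 by rewrite gt_eqF.
have dden := is_deriveD (is_derive_rho v oz) (is_derive_shift z v 0 a).
pose den : 'rV[R]_2 -> R := rho + (fun z => z 0 0 - a).
have dinv : is_derive z v (fun y => (den y)^-1) (- den z ^- 2 *: 'D_v den z).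
  by apply: DeriveDef; [apply: derivableV => //; exact: ex_derive|exact: deriveV].
rewrite (@derive_val _ _ _ _ _ _ _ dden) in dinv.
have dM := is_deriveM (is_derive_shift z v 1 b) dinv.
rewrite (@derive_val _ _ _ _ _ _ _ dM) /GRing.scale/= /psi.
have := sqr_radius (z 0 0 - a) (z 0 1 - b).
have := radius_gt0 oz; move: oz oz'; rewrite /off_ray.
set r := radius _ _; set X := _ - a; set Y := _ - b => rX rX' r0 r2.
(* The squared cosine of the half angle, simplified by [Y ^+ 2 = (r - X) * (r + X)]. *)
have -> : (1 + (Y / (r + X)) ^+ 2)^-1 = (r + X) / (2 * r).
  have -> : 1 + (Y / (r + X)) ^+ 2 = 2 * r / (r + X).
    have Y2 : Y ^+ 2 = (r - X) * (r + X) by lra.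
    by rewrite expr_div_n Y2; field.
  by rewrite invf_div.
have -> : den z = r + X by [].
(* The two sides differ by a multiple of [r ^+ 2 - (X ^+ 2 + Y ^+ 2)], which [r2] makes zero. *)
apply/subr0_eq; transitivity
  (v 0 1 * (r ^+ 2 - (X ^+ 2 + Y ^+ 2)) / (r ^+ 2 * (r + X))); last first.
  by rewrite r2 subrr mulr0 mul0r.
by field; rewrite rX' gt_eqF.
Qed.

Lemma range_angleE z :
  range_angle a b z = rho z *: delta_mx 0 0 + theta z *: delta_mx 0 1.
Proof.
apply/rowP => i; rewrite !mxE.
by case: i => [[|[|//]] ?]; rewrite !eqE/= ?(mulr0, mulr1, addr0, add0r).
Qed.

Lemma differentiable_range_angle z :
  off_ray z -> differentiable (range_angle a b) z.
Proof.
move=> oz; have -> : range_angle a b =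
    (fun z => rho z *: delta_mx 0 0) + (fun z => theta z *: delta_mx 0 1).
  by apply/funext => y; rewrite range_angleE.
apply: differentiableD; apply: differentiableZl.
  exact: differentiable_rho.
exact: differentiable_theta.
Qed.

Lemma jacobian_range_angle z v : off_ray z ->
  let X := z 0 0 - a in let Y := z 0 1 - b in
  v *m 'J (range_angle a b) z =
    ((X * v 0 0 + Y * v 0 1) / radius X Y) *: delta_mx 0 0 +
    ((X * v 0 1 - Y * v 0 0) / radius X Y ^+ 2) *: delta_mx 0 1.
Proof.
move=> oz X Y; have dh := differentiable_range_angle oz.
rewrite -deriveEjacobian// derive_mx; last exact: diff_derivable.
apply/rowP => i; rewrite !mxE.
case: i => [[|[|//]] ?]; rewrite !eqE/= ?(mulr0, mulr1, addr0, add0r).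
- rewrite -(@derive_val _ _ _ _ _ _ _ (is_derive_rho v oz)).
  by congr ('D_v _ z); apply/funext => y; rewrite !mxE.
- rewrite -(@derive_val _ _ _ _ _ _ _ (is_derive_theta v oz)).
  by congr ('D_v _ z); apply/funext => y; rewrite !mxE.
Qed.

End range_angle.

(** * The closed unit disc and the unit circle *)

Section disc.
Context {R : realType} (n : nat).
Implicit Types u : 'rV[R]_n.

Lemma euclid_norm_le1 u : (euclid_norm u <= 1) = (sqr_norm u <= 1).
Proof. by rewrite -[in LHS]sqrtr1 ler_sqrt. Qed.

Lemma euclid_norm_eq1 u : euclid_norm u = 1 <-> sqr_norm u = 1.
Proof.
have u0 : 0 <= sqr_norm u by apply: sumr_ge0 => i _; exact: sqr_ge0.
split=> [u1|u1]; last by rewrite /euclid_norm -/(sqr_norm u) u1 sqrtr1.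
by rewrite -[LHS]sqr_sqrtr// -/(euclid_norm u) u1 expr1n.
Qed.

Lemma closed_disc_compact : compact [set u : 'rV[R]_n | euclid_norm u <= 1].
Proof.
apply: bounded_closed_compact.
  exists 1; split => // M M1 u /=; rewrite euclid_norm_le1 => u1.
  apply: le_trans (ltW M1); apply: sqr_norm_le => //.
  by rewrite expr1n.
have -> : [set u : 'rV[R]_n | euclid_norm u <= 1] = @sqr_norm R n @^-1` [set x | x <= 1].
  by apply/funext => u /=; rewrite euclid_norm_le1.
apply: preimage_closed.
  by move=> u _; exact: sqr_norm_continuous.
exact: closed_le.
Qed.

Lemma circle_compact : compact [set u : 'rV[R]_n | euclid_norm u = 1].
Proof.
apply: subclosed_compact closed_disc_compact _; last by move=> u /= ->.
have -> : [set u : 'rV[R]_n | euclid_norm u = 1] = @sqr_norm R n @^-1` [set 1].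
  by apply/seteqP; split => u /euclid_norm_eq1.
apply: preimage_closed; first by move=> u _; exact: sqr_norm_continuous.
exact: closed_eq.
Qed.

Lemma disc_interior :
  [set u : 'rV[R]_n | euclid_norm u <= 1] `\` [set u : 'rV[R]_n | euclid_norm u = 1] `<=`
  interior [set u : 'rV[R]_n | euclid_norm u <= 1].
Proof.
move=> u [/= + u1]; rewrite euclid_norm_le1 le_eqVlt => /predU1P[/euclid_norm_eq1//|].
move=> ult; have unear : \forall y \near u, sqr_norm y < 1.
  exact: @sqr_norm_continuous R n u [set x | x < 1] (lt_nbhsl ult).
by apply: filterS unear => y /= y1; rewrite euclid_norm_le1 ltW.
Qed.

Lemma euclid_norm_normalized u : u != 0 ->
  exists2 s : R, 0 < s & euclid_norm (s *: u) = 1.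
Proof.
move=> u0; have nu0 : 0 < sqr_norm u.
  rewrite lt0r sumr_ge0 ?andbT; last by move=> i _; exact: sqr_ge0.
  apply: contra_neq u0 => /eqP; rewrite psumr_eq0; last first.
    by move=> i _; exact: sqr_ge0.
  move=> /allP u0; apply/rowP => i; rewrite mxE; apply/eqP.
  by rewrite -sqrf_eq0; apply: u0; rewrite mem_index_enum.
exists (Num.sqrt (sqr_norm u))^-1; first by rewrite invr_gt0 sqrtr_gt0.
apply/euclid_norm_eq1; rewrite /sqr_norm.
under eq_bigr do rewrite mxE exprMn.
by rewrite -mulr_sumr exprVn sqr_sqrtr ?mulVf ?gt_eqF// ltW.
Qed.

End disc.

(** * Linear maps, and the kernel of a difference of Jacobians *)

Lemma differentiable_mulmxr (R : numFieldType) m n (M : 'M[R]_(m, n))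
    (u : 'rV[R]_m) : differentiable (fun v : 'rV[R]_m => v *m M) u.
Proof.
have -> : (fun v : 'rV[R]_m => v *m M) =
    \sum_(i < m) (fun v : 'rV[R]_m => v 0 i *: row i M).
  by apply/funext => v; rewrite fct_sumE mulmx_sum_row.
apply: differentiable_sum => i; apply: differentiableZl.
exact: differentiable_coord.
Qed.

Instance is_diff_mulmxr (R : numFieldType) m n (M : 'M[R]_(m, n))
    (u : 'rV[R]_m) :
  is_diff u (fun v : 'rV[R]_m => v *m M) (fun v : 'rV[R]_m => v *m M).
Proof.
apply: DiffDef; first exact: differentiable_mulmxr.
apply: (@diff_lin _ _ _ (mulmxr M)) => v.
exact/differentiable_continuous/differentiable_mulmxr.
Qed.

(* With z the polar vector of radius r and z0 that of radius r0, the rows of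
   'J h z - 'J h x are A = z / r - z0 / r0 and the rotation by a right angle of
   B = z / r^2 - z0 / r0^2. Their determinant is the dot product
   A.B = (1/r + 1/r0) (1 - z.z0 / (r r0)). *)
Lemma jacobian_kernel (R : realType) (X Y X0 Y0 v1 v2 : R) :
  let r := radius X Y in let r0 := radius X0 Y0 in
  0 < r -> 0 < r0 ->
  (X * v1 + Y * v2) / r = (X0 * v1 + Y0 * v2) / r0 ->
  (X * v2 - Y * v1) / r ^+ 2 = (X0 * v2 - Y0 * v1) / r0 ^+ 2 ->
  (v1 = 0 /\ v2 = 0) \/ X * X0 + Y * Y0 = r * r0.
Proof.
move=> r r0 r_gt0 r0_gt0 Av Bv.
have r2 : r ^+ 2 = X ^+ 2 + Y ^+ 2 := sqr_radius X Y.
have r02 : r0 ^+ 2 = X0 ^+ 2 + Y0 ^+ 2 := sqr_radius X0 Y0.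
have [rn0 r0n0] : r != 0 /\ r0 != 0 by rewrite !gt_eqF.
pose A1 := X / r - X0 / r0; pose A2 := Y / r - Y0 / r0.
pose B1 := X / r ^+ 2 - X0 / r0 ^+ 2; pose B2 := Y / r ^+ 2 - Y0 / r0 ^+ 2.
have {}Av : A1 * v1 + A2 * v2 = 0.
  transitivity ((X * v1 + Y * v2) / r - (X0 * v1 + Y0 * v2) / r0).
    by rewrite /A1 /A2; field; rewrite rn0 r0n0.
  by rewrite Av subrr.
have {}Bv : B1 * v2 - B2 * v1 = 0.
  transitivity ((X * v2 - Y * v1) / r ^+ 2 - (X0 * v2 - Y0 * v1) / r0 ^+ 2).
    by rewrite /B1 /B2; field; rewrite rn0 r0n0.
  by rewrite Bv subrr.
have AB : A1 * B1 + A2 * B2 = (r^-1 + r0^-1) * (1 - (X * X0 + Y * Y0) / (r * r0)).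
  transitivity ((X ^+ 2 + Y ^+ 2) / r ^+ 3 + (X0 ^+ 2 + Y0 ^+ 2) / r0 ^+ 3 -
    (X * X0 + Y * Y0) / (r * r0) * (r^-1 + r0^-1)).
    by rewrite /A1 /A2 /B1 /B2; field; rewrite rn0 r0n0.
  by rewrite -r2 -r02; field; rewrite rn0 r0n0.
have [AB0|ABn0] := eqVneq (A1 * B1 + A2 * B2) 0.
  (* The factor [r^-1 + r0^-1] is positive, so the other one vanishes. *)
  right; move: AB0; rewrite AB => /eqP; rewrite mulf_eq0 gt_eqF/=; last first.
    by rewrite addr_gt0 ?invr_gt0.
  rewrite subr_eq0 eq_sym => /eqP D1.
  by rewrite -[LHS](@divfK _ (r * r0)) ?D1 ?mul1r// mulf_neq0.
(* Cramer's rule: combining the two equations isolates each unknown, multiplied by the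
   determinant. *)
left; split; apply: (mulfI ABn0); rewrite mulr0.
  transitivity (B1 * (A1 * v1 + A2 * v2) - A2 * (B1 * v2 - B2 * v1)); first by ring.
  by rewrite Av Bv; ring.
transitivity (B2 * (A1 * v1 + A2 * v2) + A1 * (B1 * v2 - B2 * v1)); first by ring.
by rewrite Av Bv; ring.
Qed.

(** Equality case of Cauchy-Schwarz: the hypothesis makes the squared norm of
    [(X * r0 - r * X0, Y * r0 - r * Y0)] vanish. *)
Lemma radius_aligned (R : realType) (X Y X0 Y0 : R) :
  0 < radius X0 Y0 -> X * X0 + Y * Y0 = radius X Y * radius X0 Y0 ->
  let l := radius X Y / radius X0 Y0 in X = l * X0 /\ Y = l * Y0.
Proof.
move=> r0_gt0 D l; rewrite {}/l.
have := sqr_radius X Y; have := sqr_radius X0 Y0.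
set r := radius X Y in D *; set r0 := radius X0 Y0 in r0_gt0 D * => r02 r2.
have : (X * r0 - r * X0) ^+ 2 + (Y * r0 - r * Y0) ^+ 2 = 0.
  transitivity (r0 ^+ 2 * (X ^+ 2 + Y ^+ 2) + r ^+ 2 * (X0 ^+ 2 + Y0 ^+ 2) -
    2 * (r * r0) * (X * X0 + Y * Y0)); first by ring.
  by rewrite -r2 -r02 D; ring.
move/eqP; rewrite paddr_eq0 ?sqr_ge0// !sqrf_eq0 !subr_eq0.
move=> /andP[/eqP Xr /eqP Yr].
by split; apply: (mulIf (lt0r_neq0 r0_gt0)); rewrite ?Xr ?Yr mulrAC divfK ?gt_eqF.
Qed.

(** Along a half-line from [(a, b)] the angle is constant and the range is affine, so [h] agrees
    with its first-order expansion at [x]. *)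
Lemma range_angle_ray (R : realType) (a b l : R) (x z : 'rV[R]_2) :
  let h := range_angle a b in
  off_ray a b x -> 0 < l ->
  z 0 0 - a = l * (x 0 0 - a) -> z 0 1 - b = l * (x 0 1 - b) ->
  h z - h x - (z - x) *m 'J h x = 0.
Proof.
move=> h ox l0 zX zY.
have r0 := radius_gt0 ox; have r2 := sqr_radius (x 0 0 - a) (x 0 1 - b).
rewrite /h jacobian_range_angle// !range_angleE zX zY polar_angleZ//.
rewrite radiusZ ?ltW// !mxE.
have -> : z 0 0 - x 0 0 = (l - 1) * (x 0 0 - a) by rewrite mulrBl -zX; ring.
have -> : z 0 1 - x 0 1 = (l - 1) * (x 0 1 - b) by rewrite mulrBl -zY; ring.
set r := radius _ _ in r0 r2 *; set X := _ - a in r2 *; set Y := _ - b in r2 *.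
have -> : (X * ((l - 1) * X) + Y * ((l - 1) * Y)) / r = l * r - r.
  transitivity ((l - 1) * (X ^+ 2 + Y ^+ 2) / r); first by ring.
  by rewrite -r2; field; rewrite gt_eqF.
have -> : X * ((l - 1) * Y) - Y * ((l - 1) * X) = 0 by ring.
by apply/rowP => i; rewrite !mxE; ring.
Qed.

(** A nonzero [v] in the kernel of ['J h z - 'J h x] forces equality in Cauchy-Schwarz, and then [l]
    is the ratio of the radii. *)
Lemma range_angle_jacobian_eq (R : realType) (a b : R) (z x v : 'rV[R]_2) :
  let h := range_angle a b in
  off_ray a b z -> off_ray a b x -> v *m 'J h z = v *m 'J h x ->
  v = 0 \/ exists2 l, 0 < l &
    z 0 0 - a = l * (x 0 0 - a) /\ z 0 1 - b = l * (x 0 1 - b).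
Proof.
move=> h oz ox Jzx; have Jz := esym (jacobian_range_angle v oz).
have {Jzx}Jv := etrans Jz (etrans Jzx (jacobian_range_angle v ox)).
have r_gt0 := radius_gt0 oz; have r0_gt0 := radius_gt0 ox.
move/rowP in Jv; have := Jv 0; have := Jv 1.
rewrite !mxE/= !mulr0 !mulr1 !addr0 !add0r => Jv1 Jv0.
have [[v0 v1]|al] := jacobian_kernel r_gt0 r0_gt0 Jv0 Jv1; [left|right].
  apply/rowP => i; rewrite mxE.
  case: i => [[|[|//]] i2]; [rewrite -[RHS]v0|rewrite -[RHS]v1];
    by congr (v _ _); exact: val_inj.
exists (radius (z 0 0 - a) (z 0 1 - b) / radius (x 0 0 - a) (x 0 1 - b)).
  exact: divr_gt0.
exact: radius_aligned al.
Qed.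

Theorem theorem4p4 (R : realType) (a b : R) (x : 'rV[R]_2) (P E : 'M[R]_2) :
  sym_posdef P ->
  is_cholesky_factor P E ->
  [set x + u *m E^T | u in [set u : 'rV[R]_2 | euclid_norm u <= 1]]
    `&` [set z : 'rV[R]_2 | z 0 0 <= a /\ z 0 1 = b] = set0 ->
  let h := range_angle a b in
  let g (u : 'rV[R]_2) := h (x + u *m E^T) - h x - u *m E^T *m 'J h x in
  boundary (g @` [set u : 'rV[R]_2 | euclid_norm u <= 1])
    `<=` g @` [set u : 'rV[R]_2 | euclid_norm u = 1].
Proof.
move=> _ [E_trig E_diag _] disc_ray h g.
have Eunit : E^T \in unitmx.
  rewrite unitmx_tr unitmxE det_trig// unitfE gt_eqF//.
  by apply: prodr_gt0 => i _; exact: E_diag.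
have off_disc u : euclid_norm u <= 1 -> off_ray a b (x + u *m E^T).
  move=> u1; apply/off_rayP => -[X0 Y0].
  suff : set0 (x + u *m E^T) by [].
  rewrite -disc_ray; split; first by exists u.
  by split; [rewrite -subr_le0|exact: subr0_eq].
have off_x : off_ray a b x.
  rewrite -[x]addr0 -(mul0mx _ E^T); apply: off_disc.
  by rewrite euclid_norm_le1 /sqr_norm big1// => i _; rewrite mxE expr0n.
(* The differential of [g] is [E^T] followed by the difference of the Jacobians of [h] at the moved
   point and at [x]. *)
have dg u : euclid_norm u <= 1 -> is_diff u g
    (fun w => w *m E^T *m 'J h (x + u *m E^T) - w *m E^T *m 'J h x).
  move=> /off_disc /differentiable_range_angle dh.
  have dhx := differentiableP dh.
  have daff : is_diff u (fun v => x + v *m E^T) (fun v => v *m E^T).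
    by apply: is_diff_eq; rewrite add0r.
  have dlin := is_diff_comp (is_diff_mulmxr E^T u)
    (is_diff_mulmxr ('J h x) (u *m E^T)).
  have dcomp := is_diff_comp daff dhx.
  have := is_diffB (is_diffB dcomp (is_diff_cst (h x) u)) dlin.
  move=> /is_diff_eq; apply; apply/funext => w; rewrite !fctE/= subr0.
  by congr (_ - _); rewrite -deriveEjacobian// deriveE.
apply: boundary_image_sub.
- exact: closed_disc_compact.
- exact: circle_compact.
- by move=> u /= ->.
- exact: disc_interior.
- apply: continuous_in_subspaceT => u /set_mem /dg du.
  exact: differentiable_continuous.
- by move=> u [/dg du _].
move=> u [u1 _] Jg; pose z := x + u *m E^T.
(* Off the half-line the difference of Jacobians has trivial kernel; as [E^T] is invertible,
   ['J g u] would then have full rank. *)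
have [l l_gt0 [zX zY]] : exists2 l, 0 < l &
    z 0 0 - a = l * (x 0 0 - a) /\ z 0 1 - b = l * (x 0 1 - b).
  apply: contrapT => nalign; move: Jg; apply/negP; rewrite negbK.
  rewrite row_full_unit -row_free_unit; apply: inj_row_free => w.
  have du := dg _ u1.
  rewrite -deriveEjacobian// deriveE// diff_val => /subr0_eq Jw.
  have := @range_angle_jacobian_eq R a b z x _ (off_disc _ u1) off_x Jw.
  case=> [v0|/nalign[]].
  by rewrite -[w](mulmxK Eunit) v0 mul0mx.
have gu0 : g u = 0.
  rewrite -(range_angle_ray off_x l_gt0 zX zY).
  by rewrite /g -/z [z - x]addrAC subrr add0r.
(* The direction from [(a, b)] to [x]. Pulled back by [E^T], it spans the chord through the centre
   of the disc on which [g] vanishes. *)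
pose d := (\row_i if i == 0 then x 0 0 - a else x 0 1 - b) : 'rV[R]_2.
have dn0 : d *m invmx E^T != 0.
  apply: contraTneq (radius_gt0 off_x) => /(congr1 (mulmx^~ E^T)).
  rewrite mulmxKV// mul0mx => /rowP d0.
  have := d0 0; have := d0 1; rewrite !mxE/= => -> ->.
  by rewrite /radius expr0n addr0 sqrtr0 ltxx.
(* The chord meets the circle at a point sent to [x + s *: d], which is [(a, b)] plus
   [(1 + s) *: d]. Since [1 + s] is positive it lies on the half-line, so [g] takes the value
   [0 = g u] there. *)
have [s s_gt0 s1] := euclid_norm_normalized dn0.
exists (s *: (d *m invmx E^T)) => //; rewrite gu0.
have cE : s *: (d *m invmx E^T) *m E^T = s *: d by rewrite -scalemxAl mulmxKV.
rewrite /g cE -(@range_angle_ray _ a b (1 + s) x (x + s *: d))//.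
- by rewrite [x + _ - x]addrAC subrr add0r.
- by rewrite addr_gt0.
- by rewrite !mxE/=; ring.
- by rewrite !mxE/=; ring.
Qed.
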